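(* (Exchange rule.) Let $L$ be a frame, let $(P;e)$ and $(Q;e')$ be $L$-complete lattices and let $f,g:P\to Q$ and $h:Q\to P$ be monotone maps. If $f$ possesses a (fuzzy) right adjoint $f':Q\to P$, then $$e'\Big(f\circ h\circ g\big(f'(\sqcap S_{g\circ h})\big),\ g\circ h\circ f\big(f'(\sqcap S_{g\circ h})\big)\Big)\le e'\big(\sqcap S_{f\circ h},\sqcap S_{g\circ h}\big).$$
   Context: A frame is a complete lattice $L$ (with bottom $0$, top $1$) satisfying $a\wedge\bigvee S=\bigvee_{s\in S}(a\wedge s)$ for all $a\in L$, $S\subseteq L$; its relative pseudocomplement is $a\to b=\bigvee\{x\in L\mid a\wedge x\le b\}$. $L^P$ is the set of all maps $P\to L$. An $L$-ordered set is a pair $(P;e)$ with $P$ a set and $e:P\times P\to L$ a map such that for all $x,y,z\in P$: (E1) $e(x,x)=1$; (E2) $e(x,y)\wedge e(y,z)\le e(x,z)$; (E3) $e(x,y)=e(y,x)=1$ implies $x=y$. For $S\in L^P$, an element $x_0\in P$ is the join of $S$, written $x_0=\sqcup S$, if for all $x\in P$: $S(x)\le e(x,x_0)$ and $\bigwedge_{y\in P}(S(y)\to e(y,x))\le e(x_0,x)$. It is the meet, $x_0=\sqcap S$, if for all $x\in P$: $S(x)\le e(x_0,x)$ and $\bigwedge_{y\in P}(S(y)\to e(x,y))\le e(x,x_0)$. Joins and meets are unique when they exist. $(P;e)$ is an $L$-complete lattice if $\sqcup S$ and $\sqcap S$ exist for every $S\in L^P$. A map $f:(P;e)\to(Q;e')$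 is monotone if $e(x,y)\le e'(f(x),f(y))$ for all $x,y\in P$. The map $f':Q\to P$ is a (fuzzy) right adjoint of $f:P\to Q$ if both $f$ and $f'$ are monotone and $e'(f(x),y)=e(x,f'(y))$ for all $x\in P$, $y\in Q$. For a self-map $k$ of an $L$-ordered set $(X;e_X)$, $S_k:X\to L$ is defined by $S_k(x)=e_X(k(x),x)$. *)

(* Defs.v *)
From HB Require Import structures.
From mathcomp Require Import all_boot all_order.
From mathcomp Require Import boolp classical_sets.

Set Implicit Arguments.
Unset Strict Implicit.
Unset Printing Implicit Defensive.

Import Order.TTheory.

Local Open Scope classical_set_scope.
Local Open Scope order_scope.

HB.mixin Record TBLattice_isFrame (d : Order.disp_t) L
    of Order.TBLattice d L := {
  bigjoin : set L -> L;
  bigmeet : set L -> L;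
  bigjoinP : forall A : set L, supremums A (bigjoin A);
  bigmeetP : forall A : set L, infimums A (bigmeet A);
  meet_bigjoin : forall (a : L) (A : set L),
    Order.meet a (bigjoin A) = bigjoin [set Order.meet a s | s in A]
}.

#[short(type="frameType")]
HB.structure Definition Frame (d : Order.disp_t) :=
  { L of TBLattice_isFrame d L & Order.TBLattice d L }.

Definition himp d (L : frameType d) (a b : L) : L :=
  bigjoin [set x : L | Order.meet a x <= b].

HB.mixin Record isLOrdered (d : Order.disp_t) (L : frameType d) (P : Type) := {
  lle : P -> P -> L;
  lle_refl : forall x : P, lle x x = \top;
  lle_trans : forall x y z : P, Order.meet (lle x y) (lle y z) <= lle x z;
  lle_anti : forall x y : P, lle x y = \top -> lle y x = \top -> x = y
}.

#[short(type="lOrderedType")]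
HB.structure Definition LOrdered (d : Order.disp_t) (L : frameType d) :=
  { P of isLOrdered d L P }.

Definition is_ljoin d (L : frameType d) (P : lOrderedType L)
    (S : P -> L) (x0 : P) : Prop :=
  forall x : P, S x <= lle x x0 /\
    bigmeet (range (fun y : P => himp (S y) (lle y x))) <= lle x0 x.

Definition is_lmeet d (L : frameType d) (P : lOrderedType L)
    (S : P -> L) (x0 : P) : Prop :=
  forall x : P, S x <= lle x0 x /\
    bigmeet (range (fun y : P => himp (S y) (lle x y))) <= lle x x0.

HB.mixin Record LOrdered_isComplete (d : Order.disp_t) (L : frameType d) P
    of LOrdered d L P := {
  ex_ljoin : forall S : P -> L, exists x0 : P, is_ljoin S x0;
  ex_lmeet : forall S : P -> L, exists x0 : P, is_lmeet S x0
}.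

#[short(type="lCompleteType")]
HB.structure Definition LComplete (d : Order.disp_t) (L : frameType d) :=
  { P of LOrdered_isComplete d L P & LOrdered d L P }.

Definition lmeet d (L : frameType d) (P : lCompleteType L) (S : P -> L) : P :=
  sval (cid (ex_lmeet S)).

Definition lmonotone d (L : frameType d) (P Q : lOrderedType L)
    (f : P -> Q) : Prop :=
  forall x y : P, lle x y <= lle (f x) (f y).

Definition right_adjoint d (L : frameType d) (P Q : lOrderedType L)
    (f : P -> Q) (f' : Q -> P) : Prop :=
  [/\ lmonotone f, lmonotone f' &
      forall (x : P) (y : Q), lle (f x) y = lle x (f' y)].

(* The degree to which [x] is a prefixpoint of [k]. *)
Definition prefix_degree d (L : frameType d) (X : lOrderedType L)
    (k : X -> X) : X -> L :=
  fun x => lle (k x) x.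

(* Main.v *)
(** Write [b] for the meet of the prefix degrees of [g \o h] and [u := f' b].
    As [f u <= b] and [g (h b) <= b], the left-hand side is at most
    [e' (f (h (g u)), b) = e (h (g u), u)]. The latter bounds the degree to
    which [g u] is a prefixpoint of [g \o h], hence [e' (b, g u)], and so it is
    at most [e (h b, u) = e' (f (h b), b)], the degree to which [b] is a
    prefixpoint of [f \o h]. *)

Require Import Defs.
From mathcomp Require Import all_boot all_order.
From mathcomp Require Import boolp.

Import Order.TTheory.

Local Open Scope order_scope.

Section LOrderedTheory.
Context {d : Order.disp_t} {L : frameType d}.

Lemma le_himp (a b c : L) : Order.meet a c <= b -> c <= himp a b.
Proof. by move=> le_ac_b; apply: (proj1 (bigjoinP _)). Qed.

Lemma le_lle_trans (P : lOrderedType L) (y x z : P) (a : L) :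
  a <= lle x y -> a <= lle y z -> a <= lle x z.
Proof.
by move=> axy ayz; apply: le_trans (lle_trans x y z); rewrite lexI axy.
Qed.

Lemma lmeet_lb (P : lCompleteType L) (S : P -> L) (x : P) :
  S x <= lle (lmeet S) x.
Proof. by rewrite /lmeet; case: cid => m /= /(_ x)[]. Qed.

(** Each [himp (S y) (lle x y)] is then [\top], hence so is their meet. *)
Lemma lmeet_glb (P : lCompleteType L) (S : P -> L) (x : P) :
  (forall y, S y <= lle x y) -> lle x (lmeet S) = \top.
Proof.
move=> Sx; apply/eqP; rewrite -le1x /lmeet; case: cid => m /= /(_ x)[_].
apply: le_trans; apply: (proj2 (bigmeetP _)) => _ [y _ <-].
by apply: le_himp; rewrite meetx1.
Qed.

(** With [m] the meet, [k m <= k y <= y] holds to the degree that [y] is a prefixpoint, so [k m] is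
    a lower bound. *)
Lemma lle_prefix_lmeet (P : lCompleteType L) (k : P -> P) :
  lmonotone k ->
  lle (k (lmeet (prefix_degree k))) (lmeet (prefix_degree k)) = \top.
Proof.
move=> k_mono; apply: lmeet_glb => y; apply: (le_lle_trans _ (k y)) => //.
exact: le_trans (lmeet_lb _ _ _) (k_mono _ _).
Qed.

End LOrderedTheory.

Theorem corollary3p11 (d : Order.disp_t) (L : frameType d)
    (P Q : lCompleteType L) (f g : P -> Q) (h : Q -> P) (f' : Q -> P)
    (f_mono : lmonotone f) (g_mono : lmonotone g) (h_mono : lmonotone h)
    (f_adj : right_adjoint f f') :
  (lle ((f \o h \o g) (f' (lmeet (prefix_degree (g \o h)))))
       ((g \o h \o f) (f' (lmeet (prefix_degree (g \o h)))))
   <= lle (lmeet (prefix_degree (f \o h))) (lmeet (prefix_degree (g \o h))))%O.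
Proof.
case: f_adj => _ _ adj; set b := lmeet (prefix_degree (g \o h)).
have gh_mono : lmonotone (g \o h).
  by move=> x y; apply: le_trans (h_mono x y) (g_mono _ _).
have ghb : lle (g (h b)) b = \top := lle_prefix_lmeet _ _ gh_mono.
set u := f' b; rewrite /=.
have fu : lle (f u) b = \top by rewrite adj lle_refl.
have ghfu : lle (g (h (f u))) b = \top.
  apply/eqP; rewrite -le1x; apply: (le_lle_trans _ (g (h b))).
    (* Reading [\top] as [lle (f u) b] makes this an instance of monotonicity. *)
    by rewrite -fu; apply: gh_mono.
  by rewrite ghb.
have hgu : lle (f (h (g u))) (g (h (f u))) <= lle (h (g u)) u.
  by rewrite -adj; apply: (le_lle_trans _ (g (h (f u)))); rewrite ?ghfu ?lex1.
apply: le_trans hgu (le_trans _ (lmeet_lb _ (prefix_degree (f \o h)) b)).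
rewrite /prefix_degree /= adj; apply: (le_lle_trans _ (h (g u))) => //.
apply: le_trans (h_mono b (g u)).
(* Applying [g] to both sides of [lle (h (g u)) u] gives the prefix degree at [g u]. *)
exact: le_trans (g_mono _ _) (lmeet_lb _ (prefix_degree (g \o h)) (g u)).
Qed.
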